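(* For any integer $n_0$ with $\underline n\le n_0\le\overline n$, an optimal dynamic quotation strategy for the problem $$H(n_0)=\sup_{D_{n_0}}P(n_0,D_{n_0})$$ over the vectors $D_{n_0}$ admissible for $n_0$ is $$D^P_{n_0}=(\tilde d^P_0,\ldots,\tilde d^P_{n_0-1},\tilde d^P_{n_0}+\epsilon)$$ for any $\epsilon>0$ with $\tilde d^P_{n_0}+\epsilon\ge0$.
   Context: Parameters: $\lambda,\mu>0$ (arrival and service rates), $\rho=\lambda/\mu$; service value $R$, entrance fee $p$, waiting cost rate $c>0$, compensation rate $l$, risk-aversion coefficient $r>0$, with $0\le p\le R$ and $0\le l\le c$. For each integer $n\ge 0$, $X_n\sim Gamma(n+1,\mu)$ has density $\mu^{n+1}x^ne^{-\mu x}/n!$ on $(0,\infty)$. A lead-time quote is $d\in[0,\infty]$; $d=\infty$ means no compensation, with $(x-\infty)^+=0$. Expected utility of a joining customer who finds $n$ customers and is quoted $d$: $$B_n(d)=E\left[\frac{1-e^{-r(R-p-cX_n+l(X_n-d)^+)}}{r}\right]\in[-\infty,\infty).$$ The customer joins iff $B_n(d)\ge 0$. Let $L_n(d)=E(X_n-d)^+$, and let $G_n(d)=p-lL_n(d)$ if $B_n(d)\ge0$, $G_n(d)=0$ if $B_n(d)<0$. Put $\underline n=\inf\{n\ge0:\lim_{d\to\infty}B_n(d)<0\}$, $\overline n=\inf\{n\ge0:B_n(0)<0\}$ (with $\inf\varnothing=\infty$), $q(n;n_0)=\rho^n/\sum_{k=0}^{n_0}\rho^k$ for $0\le n\le n_0$,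 and $\tilde d^P_n=\sup\{d\ge0:B_n(d)\ge0\}$ with $\sup\varnothing=-1$. A vector $D_{n_0}=(d_0,\ldots,d_{n_0})\in[0,\infty]^{n_0+1}$ is admissible for $n_0$ if $B_n(d_n)\ge0$ for $n=0,\ldots,n_0-1$ and $B_{n_0}(d_{n_0})<0$ (so that the balking threshold is $n_0$). The profit is $P(n_0,D_{n_0})=\lambda\sum_{n=0}^{n_0-1}q(n;n_0)G_n(d_n)$. *)

(* Defs.v *)
From HB Require Import structures.
From mathcomp Require Import all_boot all_order all_algebra.
From mathcomp Require Import all_classical all_reals all_analysis.

Set Implicit Arguments.
Unset Strict Implicit.
Unset Printing Implicit Defensive.

Import Order.TTheory GRing.Theory Num.Theory.
Import numFieldNormedType.Exports.

Local Open Scope classical_set_scope.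
Local Open Scope ring_scope.

Record params (R : realType) := Params {
  arrival_rate : R;
  service_rate : R;
  service_value : R;
  entrance_fee : R;
  waiting_cost : R;
  compensation : R;
  risk_aversion : R
}.

(* Density of Gamma(n+1, m): the shape parameter is n+1, not n. *)
Definition gamma_pdf (R : realType) (n : nat) (m x : R) : R :=
  if 0 < x then m ^+ n.+1 * x ^+ n * expR (- m * x) / n`!%:R else 0.

Definition has_gamma_law (R : realType) (disp : measure_display)
    (T : measurableType disp) (P : probability T R) (Y : {RV P >-> R})
    (n : nat) (m : R) : Prop :=
  forall A : set R, measurable A ->
    distribution P Y A = (\int[lebesgue_measure]_(x in A) (gamma_pdf n m x)%:E)%E.

(* (x - d)^+, with (x - oo)^+ = 0. Quotes are nonnegative, so the case
   d = -oo never occurs. *)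
Definition lateness (R : realType) (x : R) (d : \bar R) : R :=
  if d is d'%:E then Num.max (x - d') 0 else 0.

Section Model.
Context (R : realType) (disp : measure_display) (T : measurableType disp).
Context (P : probability T R) (X : nat -> {RV P >-> R}) (Q : params R).

Definition load : R := arrival_rate Q / service_rate Q.

(* The integrand is bounded above but not always integrable, so the
   expectation is extended-real valued and may be -oo. *)
Definition util (n : nat) (d : \bar R) : \bar R :=
  'E_P[fun w => (1 - expR (- (risk_aversion Q *
        (service_value Q - entrance_fee Q - waiting_cost Q * X n w
         + compensation Q * lateness (X n w) d)))) / risk_aversion Q].

Definition exp_lateness (n : nat) (d : \bar R) : \bar R :=
  'E_P[fun w => lateness (X n w) d].

Definition gain (n : nat) (d : \bar R) : \bar R :=
  (if 0 <= util n d
   then (entrance_fee Q)%:E - (compensation Q)%:E * exp_lateness n d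
   else 0)%E.

(* Infima in N u {oo} are taken in the extended reals, where inf set0 = +oo. *)
Definition n_lower : \bar R :=
  ereal_inf [set n%:R%:E | n in
    [set n : nat | (lim (util n x%:E @[x --> +oo%R]) < 0)%E]].

Definition n_upper : \bar R :=
  ereal_inf [set n%:R%:E | n in [set n : nat | (util n 0 < 0)%E]].

Definition queue_prob (n n0 : nat) : R :=
  load ^+ n / \sum_(k < n0.+1) load ^+ k.

Definition joining_quotes (n : nat) : set (\bar R) :=
  [set d | (0 <= d)%E /\ (0 <= util n d)%E].

Definition dtilde (n : nat) : \bar R :=
  if `[< joining_quotes n = set0 >] then (-1)%:E
  else ereal_sup (joining_quotes n).

Definition admissible (n0 : nat) (D : 'I_n0.+1 -> \bar R) : Prop :=
  [/\ forall i, (0 <= D i)%E,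
      forall i : 'I_n0.+1, (i < n0)%N -> (0 <= util i (D i))%E
    & (util n0 (D ord_max) < 0)%E].

Definition profit (n0 : nat) (D : 'I_n0.+1 -> \bar R) : \bar R :=
  ((arrival_rate Q)%:E *
    \sum_(i < n0.+1 | (i < n0)%N) (queue_prob i n0)%:E * gain i (D i))%E.

Definition opt_profit (n0 : nat) : \bar R :=
  ereal_sup [set profit D | D in [set D : 'I_n0.+1 -> \bar R | admissible D]].

Definition optimal (n0 : nat) (D : 'I_n0.+1 -> \bar R) : Prop :=
  admissible D /\ profit D = opt_profit n0.

Definition DP (n0 : nat) (eps : R) : 'I_n0.+1 -> \bar R :=
  fun i => if (i < n0)%N then dtilde i else (dtilde n0 + eps%:E)%E.

End Model.

Arguments DP {R disp T P} X Q n0 eps _.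

(* Main.v *)
Require Import Defs.
From mathcomp Require Import all_boot all_order all_algebra.
From mathcomp Require Import all_classical all_reals all_analysis.
From mathcomp Require Import measurable_realfun ring.

Import Order.TTheory GRing.Theory Num.Theory.
Import numFieldNormedType.Exports.
Local Open Scope classical_set_scope.
Local Open Scope ring_scope.

(** The quotes of the different states do not interact.  Once the threshold
    [n0] is fixed, the state probabilities are fixed, so the profit is a
    nonnegative combination of the gains in the states [n < n0], and it is
    maximal when each gain is maximal among the quotes that make a customer
    join.  A later quote means less compensation to pay, so the best quote is
    the latest one that is still accepted, [dtilde n].  Two things remain to be
    shown: this supremum is itself accepted when [n < n0], and a quote beyond
    the supremum makes customers balk at [n0].

    Utility is an affine decreasing function of the expected exponential
    disutility [exp_disutility] ([util_disutility]), even when the latter is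
    infinite, and joining means that this disutility is at most 1.  Later
    quotes increase it, and Fatou's lemma makes the bound by 1 pass to limits
    of quotes, infinite limits included.  Hence the set of accepted quotes, if
    nonempty, contains its supremum ([sup_joining_quotes]).  It is nonempty
    for [n < n0] because [n0 <= n_upper] says that the quote 0 is accepted
    there.

    At [n0], the only danger is [dtilde n0 = +oo], for then [dtilde n0 + eps]
    is no later than the supremum.  Since the supremum is accepted, this would make the quote
    [+oo] accepted at [n0].  But [n_lower <= n0] provides some [n <= n0] where
    the quote [+oo] is refused ([lim_util_lt0]), and a longer queue only lowers
    the utility of that quote ([util_pinfty_nincr]), because the waiting times
    are stochastically increasing ([gamma_le_upset]). *)

(** * Expectation of an affine function of a nonnegative variable *)

(** When the integral of [f] is infinite both sides are [-oo]: the positive part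
    of [(1 - f) / r] is at most [1 / r], so its negative part cannot be
    integrable without [f] being so. *)
Lemma expectation_affine (R : realType) (disp : measure_display)
    (T : measurableType disp) (P : probability T R) (f : T -> R) (r : R) :
  0 < r -> measurable_fun setT f -> (forall w, 0 <= f w) ->
  ('E_P[fun w => ((1 - f w) / r)%R]
   = (1 - \int[P]_w (f w)%:E) * (r^-1)%:E)%E.
Proof.
move=> r0 mf f0; rewrite unlock.
have mEf : measurable_fun setT (EFin \o f) by exact/measurable_EFinP.
have int1 : P.-integrable setT (EFin \o cst (1 : R)).
  exact: finite_measure_integrable_cst.
have [intf|nintf] := pselect (P.-integrable setT (EFin \o f)).
  under eq_integral do rewrite EFinM.
  rewrite integralZr//; last exact: (integrableB _ int1 intf).
  under eq_integral do rewrite EFinB.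
  rewrite integralB//= integral_cst//= probability_setT mule1.
  by [].
set g := fun w => _.
have mg : measurable_fun setT (g : T -> \bar R).
  apply/measurable_EFinP; apply: measurable_funM => //.
  exact: measurable_funB.
have intf_oo : (\int[P]_w (f w)%:E = +oo)%E.
  apply/eqP; rewrite -leye_eq leNgt; apply/negP => foo; apply: nintf.
  apply/integrableP; split => //.
  by under eq_integral do rewrite /= ger0_norm//.
rewrite intf_oo /= mulNyr gtr0_sg ?invr_gt0// mul1e.
have gp_lty : (\int[P]_w (g^\+ w) < +oo)%E.
  apply: (@le_lt_trans _ _ (\int[P]_w (cst (r^-1)%:E w))%E).
    apply: ge0_le_integral => //.
    - exact: measurable_funepos.
    - move=> w _; rewrite funeposE /g /cst -EFin_max lee_fin ge_max.
      apply/andP; split; last by rewrite invr_ge0 ltW.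
      by rewrite ler_piMl ?invr_ge0 ?(ltW r0)// gerBl.
  by rewrite integral_cst//= probability_setT mule1 ltry.
have gn_oo : (\int[P]_w (g^\- w) = +oo)%E.
  apply/eqP; rewrite -leye_eq leNgt; apply/negP => goo; apply: nintf.
  have intg : P.-integrable setT g.
    apply/integrableP; split => //.
    under eq_integral do rewrite -/((abse \o g) _) fune_abse.
    rewrite ge0_integralD//.
    - exact: lte_add_pinfty.
    - exact: measurable_funepos.
    - exact: measurable_funeneg.
  have -> : EFin \o f = ((EFin \o cst (1 : R)%R) \- (fun w => r%:E * g w))%E.
    apply/funext => w; rewrite /= /g.
    have {1}-> : f w = 1 - r * ((1 - f w) / r).
      by rewrite mulrCA mulfV ?gt_eqF// mulr1 subKr.
    by [].
  by apply: integrableB => //; exact: integrableZl.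
rewrite integralE gn_oo /=.
by move: gp_lty; case: (\int[P]_w _)%E.
Qed.

(** * Dependence of lateness on the quote *)

Section Lateness.
Context {R : realType}.
Implicit Types (x : R) (d : \bar R).

Lemma lateness_ge0 x d : 0 <= lateness x d.
Proof. by case: d => [d||] //=; rewrite le_max lexx orbT. Qed.

(** The quote [-oo] must be excluded because [lateness] takes the value 0 there
    by convention. *)
Lemma lateness_le x d1 d2 :
  d1 != -oo%E -> (d1 <= d2)%E -> lateness x d2 <= lateness x d1.
Proof.
case: d1 d2 => [d1||] [d2||] //= _.
- rewrite lee_fin => d12; rewrite ge_max !le_max lexx !orbT andbT.
  by rewrite lerB.
- by rewrite le_max lexx orbT.
Qed.

Lemma measurable_lateness d :
  measurable_fun [set: R] (fun x => lateness x d).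
Proof.
case: d => [d||] //=.
by apply: measurable_maxr => //; exact: measurable_funB.
Qed.

Lemma lateness_cvg x (u : nat -> \bar R) d :
  d != -oo%E -> u k @[k --> \oo] --> d ->
  lateness x (u k) @[k --> \oo] --> lateness x d.
Proof.
case: d => [d||] // _ ud.
- have /fine_cvgP[ufin fud] := ud.
  apply: (@cvg_trans _ (Num.max (x - fine (u k)) 0 @[k --> \oo])).
    apply: near_eq_cvg; near=> k.
    have : u k \is a fin_num by near: k.
    by case: (u k).
  have max_cont : {for d, continuous ((fun t : R^o => x - t : R^o) \max cst 0)}.
    apply: continuous_max; last exact: cvg_cst.
    by apply: continuousB; [exact: cvg_cst|exact: cvg_id].
  exact: (continuous_cvg _ max_cont fud).
(* For quotes tending to [+oo], lateness vanishes once the quote exceeds [x]. *)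
- apply: cvg_near_cst; near=> k.
  have : (x%:E <= u k)%E.
    by near: k; move/cvgeyPge : ud; exact.
  case: (u k) => [v||] //=; rewrite lee_fin => xv.
  by apply/max_idPr; rewrite subr_le0.
Unshelve. all: by end_near. Qed.

End Lateness.

(** * Stochastic monotonicity of the gamma laws *)

Section StochasticOrder.
Context {R : realType} {disp : measure_display} {T : measurableType disp}.
Context {P : probability T R}.

Lemma gamma_pdf_ge0 (n : nat) (m x : R) : 0 < m -> 0 <= gamma_pdf n m x.
Proof.
move=> m0; rewrite /gamma_pdf; case: ifPn => // x0.
by rewrite divr_ge0// !mulr_ge0 ?expR_ge0 ?exprn_ge0 ?ltW.
Qed.

Lemma gamma_pdfS (n : nat) (m x : R) :
  gamma_pdf n.+1 m x = gamma_pdf n m x * (m * x / n.+1%:R).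
Proof.
rewrite /gamma_pdf; case: ifPn => _; last by rewrite mul0r.
rewrite factS natrM exprS [x ^+ _]exprS.
by field; rewrite nat1r !pnatr_eq0 -!lt0n fact_gt0.
Qed.

Lemma measurable_gamma_pdf (n : nat) (m : R) :
  measurable_fun [set: R] (gamma_pdf n m).
Proof.
apply: measurable_fun_if => //; first exact: measurable_fun_ltr.
apply: measurable_funM => //.
apply: measurable_funM.
  apply: measurable_funM => //; apply: measurable_funX; exact: measurable_id.
apply: measurableT_comp => //; apply: measurable_funM => //.
Qed.

(** Stochastic order from monotone likelihood ratio.  By [gamma_pdfS] the two
    densities cross only at [(n + 1) / m].  If the up-closed set [A] contains
    the crossing point, its complement lies to the left, where the density of
    [X] dominates; otherwise [A] lies to the right, where the density of [Y]
    dominates.  As both laws have total mass 1, no integral is computed. *)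
Lemma gamma_le_upset {X Y : {RV P >-> R}} {n : nat} {m : R} {A : set R} :
  0 < m -> has_gamma_law X n m -> has_gamma_law Y n.+1 m ->
  measurable A -> (forall x y, A x -> x <= y -> A y) ->
  (distribution P X A <= distribution P Y A)%E.
Proof.
move=> m0 hX hY mA upA.
have mf k (B : set R) : measurable_fun B (fun x => (gamma_pdf k m x)%:E).
  by apply/measurable_EFinP/measurable_funTS; exact: measurable_gamma_pdf.
have f0 k x : (0 <= (gamma_pdf k m x)%:E)%E by rewrite lee_fin gamma_pdf_ge0.
have [Ax0|nAx0] := pselect (A (n.+1%:R / m)).
- have mC : measurable (~` A) by exact: measurableC.
  have dC (Z : {RV P >-> R}) :
      distribution P Z A = (1 - distribution P Z (~` A))%E.
    by rewrite -{1}[A]setCK; exact: probability_setC.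
  rewrite !dC; apply: leeB => //; rewrite hX// hY//.
  apply: ge0_le_integral => //; [exact: mf|exact: mf|].
  move=> x nAx; rewrite lee_fin gamma_pdfS ler_piMr ?gamma_pdf_ge0//.
  rewrite ler_pdivrMr ?ltr0n// mul1r mulrC -ler_pdivlMr//.
  by rewrite leNgt; apply/negP => /ltW /(upA _ _ Ax0) /nAx.
- rewrite hX// hY//; apply: ge0_le_integral => //; [exact: mf|exact: mf|].
  move=> x Ax; rewrite lee_fin gamma_pdfS ler_peMr ?gamma_pdf_ge0//.
  rewrite ler_pdivlMr ?ltr0n// mul1r mulrC -ler_pdivrMr//.
  by rewrite leNgt; apply/negP => /ltW /(upA _ _ Ax) /nAx0.
Qed.

(** Layer-cake formula: the expectation of [g X] is the integral over [t >= 0]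
    of the probability that [g X > t], and each of these events says that [X]
    lies in an up-closed set. *)
Lemma gamma_le_expectation {X Y : {RV P >-> R}} {n : nat} {m : R} {g : R -> R} :
  0 < m -> has_gamma_law X n m -> has_gamma_law Y n.+1 m ->
  {homo g : x y / x <= y} -> measurable_fun setT g -> (forall x, 0 <= g x) ->
  (\int[P]_w (g (X w))%:E <= \int[P]_w (g (Y w))%:E)%E.
Proof.
move=> m0 hX hY gnd mg g0.
have mgZ (Z : {RV P >-> R}) : measurable_fun [set: T] (g \o Z).
  exact: measurableT_comp.
pose gRV (Z : {RV P >-> R}) : {RV P >-> R} := mfun_Sub (mem_set (mgZ Z)).
have gE (Z : {RV P >-> R}) : (\int[P]_w (g (Z w))%:E = 'E_P[gRV Z])%E.
  by rewrite unlock.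
have gRV0 (Z : {RV P >-> R}) x : 0 <= gRV Z x by exact: g0.
have mccdf (Z : {RV P >-> R}) :
    measurable_fun (`[0, +oo[ : set R) (ccdf (gRV Z)).
  by apply: measurable_funTS; exact: ccdf_measurable.
rewrite !gE !ge0_expectation_ccdf//.
apply: ge0_le_integral => //; [exact: mccdf|exact: mccdf|].
move=> t _.
have tail (Z : {RV P >-> R}) :
    ccdf (gRV Z) t = distribution P Z (g @^-1` `]t, +oo[) by [].
rewrite !tail; apply: (gamma_le_upset m0 hX hY).
  by rewrite -[X in measurable X]setTI; exact: mg.
move=> x y /=; rewrite !in_itv/= !andbT => tx xy.
exact: (lt_le_trans tx (gnd _ _ xy)).
Qed.

End StochasticOrder.

(** * Utility and profit in the queue *)

Section Queue.
Context {R : realType} {disp : measure_display} {T : measurableType disp}.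
Context {P : probability T R} {X : nat -> {RV P >-> R}} {Q : params R}.
Hypothesis risk_gt0 : 0 < risk_aversion Q.
Hypothesis comp_ge0 : 0 <= compensation Q.
Implicit Types (n : nat) (d : \bar R).

Definition disutility d (x : R) : R :=
  expR (- (risk_aversion Q *
    (service_value Q - entrance_fee Q - waiting_cost Q * x
     + compensation Q * lateness x d))).

Definition exp_disutility n d : \bar R :=
  (\int[P]_w (disutility d (X n w))%:E)%E.

Lemma measurable_disutility d : measurable_fun [set: R] (disutility d).
Proof.
apply: measurableT_comp => //; apply: measurableT_comp => //.
apply: measurable_funM => //; apply: measurable_funD.
  by apply: measurable_funB => //; exact: measurable_funM.
by apply: measurable_funM => //; exact: measurable_lateness.
Qed.

Lemma measurable_disutilityX n d :
  measurable_fun [set: T] (fun w => (disutility d (X n w))%:E).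
Proof.
apply/measurable_EFinP.
by apply: (measurableT_comp (measurable_disutility d)).
Qed.

Lemma util_disutility n d :
  (util X Q n d = (1 - exp_disutility n d) * ((risk_aversion Q)^-1)%:E)%E.
Proof.
rewrite /util expectation_affine//.
exact: (measurableT_comp (measurable_disutility d)).
Qed.

Lemma util_ge0E n d : (0 <= util X Q n d)%E = (exp_disutility n d <= 1)%E.
Proof.
rewrite util_disutility pmule_lge0 ?lte_fin ?invr_gt0//.
by rewrite sube_ge0 ?orbT.
Qed.

Lemma exp_disutility_le {n d1 d2} : d1 != -oo%E -> (d1 <= d2)%E ->
  (exp_disutility n d1 <= exp_disutility n d2)%E.
Proof.
move=> d1N d12; apply: ge0_le_integral => //.
- by move=> w _; rewrite lee_fin expR_ge0.
- exact: measurable_disutilityX.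
- exact: measurable_disutilityX.
move=> w _; rewrite lee_fin ler_expR lerN2.
by rewrite ler_wpM2l ?(ltW risk_gt0)// lerD2l ler_wpM2l// lateness_le.
Qed.

Lemma util_nincr {n d1 d2} : d1 != -oo%E -> (d1 <= d2)%E ->
  (util X Q n d2 <= util X Q n d1)%E.
Proof.
move=> d1N d12; rewrite !util_disutility.
apply: lee_wpmul2r; first by rewrite lee_fin invr_ge0 ltW.
by apply: leeB => //; exact: exp_disutility_le.
Qed.

Lemma exp_lateness_le {n d1 d2} : d1 != -oo%E -> (d1 <= d2)%E ->
  (exp_lateness X n d2 <= exp_lateness X n d1)%E.
Proof.
move=> d1N d12; rewrite /exp_lateness unlock.
have mlX d : measurable_fun [set: T] (fun w => (lateness (X n w) d)%:E).
  apply/measurable_EFinP; exact: (measurableT_comp (measurable_lateness d)).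
apply: ge0_le_integral => //.
  by move=> w _; rewrite lee_fin lateness_ge0.
by move=> w _; rewrite lee_fin lateness_le.
Qed.

(** Lower semicontinuity of the disutility in the quote.  Fatou's lemma is used
    rather than dominated convergence because the disutility need not be
    integrable. *)
Lemma exp_disutility_le_lim {n} {u : nat -> \bar R} {d c} : d != -oo%E ->
  u k @[k --> \oo] --> d -> (forall k, exp_disutility n (u k) <= c)%E ->
  (exp_disutility n d <= c)%E.
Proof.
move=> dN ud uc.
have -> : exp_disutility n d =
    (\int[P]_w limn_einf (fun k => (disutility (u k) (X n w))%:E))%E.
  apply: eq_integral => w _.
  have rcvg : disutility (u k) (X n w) @[k --> \oo] --> disutility d (X n w).
    apply: (@continuous_cvg _ _ _ _ _ _ expR); first exact: continuous_expR.
    apply: cvgN; apply: cvgM; first exact: cvg_cst.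
    apply: cvgD; first exact: cvg_cst.
    by apply: cvgM; [exact: cvg_cst|exact: lateness_cvg].
  have fcvg : (disutility (u k) (X n w))%:E @[k --> \oo]
      --> (disutility d (X n w))%:E.
    by apply: cvg_EFin => //; exact: nearW.
  rewrite is_cvg_limn_einfE; first exact/esym/cvg_lim.
  by apply/cvg_ex; eexists; exact: fcvg.
apply: le_trans (fatou _ measurableT _ _) _.
- by move=> k; exact: measurable_disutilityX.
- by move=> k w _; rewrite lee_fin expR_ge0.
rewrite limn_einf_lim; apply: lime_le; first exact: is_cvg_einfs.
apply: nearW => k; apply: le_trans (uc k).
by apply: ereal_inf_lbound; exists k => //=.
Qed.

(** The supremum, possibly [+oo], is the limit of a sequence of accepted quotes,
    along which the disutility stays at most 1. *)
Lemma sup_joining_quotes {n} : joining_quotes X Q n !=set0 ->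
  joining_quotes X Q n (ereal_sup (joining_quotes X Q n)).
Proof.
move=> J0; set s := ereal_sup _.
have s0 : (0 <= s)%E.
  by case: J0 => d Jd; apply: le_trans Jd.1 _; exact: ereal_sup_ubound.
split => //.
have [|u uJ us] := @ereal_sup_seq _ (joining_quotes X Q n); first exact/set0P.
rewrite util_ge0E; apply: (exp_disutility_le_lim _ us) => [|k].
  by rewrite -ltNye; exact: lt_le_trans s0.
by rewrite -util_ge0E; case: (uJ k).
Qed.

Lemma dtilde_sup {n} : joining_quotes X Q n !=set0 ->
  dtilde X Q n = ereal_sup (joining_quotes X Q n).
Proof.
move=> J0; rewrite /dtilde; case: asboolP => // J; rewrite J in J0.
by case: J0.
Qed.

(** Utility is nonincreasing in the quote, so its limit is an infimum and a
    negative limit is witnessed by a finite quote. *)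
Lemma lim_util_lt0 {n} :
  (lim (util X Q n x%:E @[x --> +oo%R]) < 0)%E -> (util X Q n +oo < 0)%E.
Proof.
have ninc : nonincreasing_fun (fun x : R => util X Q n x%:E).
  by move=> x y xy; exact: util_nincr.
have -> := cvg_lim (@ereal_hausdorff R) (nonincreasing_cvge ninc).
move=> /ereal_inf_lt[_ [x _ <-]]; apply: le_lt_trans.
by apply: util_nincr => //; rewrite leey.
Qed.

Section Gamma.
Hypothesis mu_gt0 : 0 < service_rate Q.
Hypothesis cost_ge0 : 0 <= waiting_cost Q.
Hypothesis gammaX : forall n, has_gamma_law (X n) n (service_rate Q).

(** Without compensation the disutility is a nondecreasing function of the
    waiting time alone, so the stochastic order of the waiting times applies. *)
Lemma util_pinfty_nincr {m n} : (m <= n)%N ->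
  (util X Q n +oo <= util X Q m +oo)%E.
Proof.
move=> /subnK <-; elim: (n - m)%N => // k; apply: le_trans.
rewrite addSn !util_disutility.
apply: lee_wpmul2r; first by rewrite lee_fin invr_ge0 ltW.
apply: leeB => //; apply: (gamma_le_expectation mu_gt0 (gammaX _) (gammaX _)).
- move=> x y xy; rewrite ler_expR lerN2 ler_wpM2l ?(ltW risk_gt0)//=.
  by rewrite lerD2r lerD2l lerN2 ler_wpM2l.
- exact: measurable_disutility.
- by move=> x; exact: expR_ge0.
Qed.

End Gamma.

Lemma util0_ge0 {n n0} : (n < n0)%N -> (n0%:R%:E <= n_upper X Q)%E ->
  (0 <= util X Q n 0)%E.
Proof.
move=> nn0 hup; rewrite leNgt; apply/negP => u0.
have : (n0%:R%:E <= n%:R%:E :> \bar R)%E.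
  by apply: (le_trans hup); apply: ereal_inf_lbound; exists n.
by rewrite lee_fin ler_nat leqNgt nn0.
Qed.

(** Comparing the infimum with [n0 + 1] rather than [n0] makes the inequality
    strict, which is what yields an element of the set below the bound. *)
Lemma n_lower_attained {n0} : (n_lower X Q <= n0%:R%:E)%E ->
  exists2 n, (n <= n0)%N & (lim (util X Q n x%:E @[x --> +oo%R]) < 0)%E.
Proof.
move=> hlow.
have : (n_lower X Q < n0.+1%:R%:E)%E.
  by apply: le_lt_trans hlow _; rewrite lte_fin ltr_nat.
by move=> /ereal_inf_lt[_ [n nlim <-]]; rewrite lte_fin ltr_nat; exists n.
Qed.

(** If no quote is accepted, [dtilde n] is [-1] and any nonnegative quote is
    refused.  Otherwise the supremum is accepted, hence finite since [+oo] is
    refused, and adding [eps] goes strictly beyond it. *)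
Lemma util_dtilde_gt {n} {eps : R} : 0 < eps -> (util X Q n +oo < 0)%E ->
  (0 <= dtilde X Q n + eps%:E)%E -> (util X Q n (dtilde X Q n + eps%:E) < 0)%E.
Proof.
move=> eps0 uoo de0; rewrite ltNge; apply/negP => ude.
have Jde : joining_quotes X Q n (dtilde X Q n + eps%:E)%E by split.
have J0 : joining_quotes X Q n !=set0 by eexists; exact: Jde.
have := ereal_sup_ubound Jde; have [s0 us] := sup_joining_quotes J0.
rewrite (dtilde_sup J0); move: s0 us.
case: ereal_sup => [s||] //= s0 us; last by rewrite leNgt uoo in us.
by rewrite -EFinD lee_fin gerDl leNgt eps0.
Qed.

(** Among accepted quotes the latest one has the least expected lateness, hence
    the least expected compensation. *)
Lemma gain_le_dtilde {n d} : (0 <= d)%E -> (0 <= util X Q n d)%E ->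
  (gain X Q n d <= gain X Q n (dtilde X Q n))%E.
Proof.
move=> d0 ud; have Jd : joining_quotes X Q n d by split.
have J0 : joining_quotes X Q n !=set0 by exists d.
rewrite dtilde_sup// /gain ud (sup_joining_quotes J0).2.
apply: leeB => //; apply: lee_wpmul2l; first by rewrite lee_fin.
apply: exp_lateness_le; last exact: ereal_sup_ubound.
by rewrite -ltNye; exact: lt_le_trans d0.
Qed.

End Queue.

Theorem proposition2 (R : realType) (disp : measure_display)
    (T : measurableType disp) (P : probability T R)
    (X : nat -> {RV P >-> R}) (Q : params R)
    (hlambda : 0 < arrival_rate Q) (hmu : 0 < service_rate Q)
    (hcost : 0 < waiting_cost Q) (hrisk : 0 < risk_aversion Q)
    (hfee : 0 <= entrance_fee Q <= service_value Q)
    (hcomp : 0 <= compensation Q <= waiting_cost Q)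
    (hX : forall n : nat, has_gamma_law (X n) n (service_rate Q))
    (n0 : nat) (hn0 : (n_lower X Q <= n0%:R%:E <= n_upper X Q)%E)
    (eps : R) (heps : 0 < eps) (hd : (0 <= dtilde X Q n0 + eps%:E)%E) :
  optimal X Q (DP X Q n0 eps).
Proof.
have /andP[l0 _] := hcomp; have /andP[hlow hup] := hn0.
have DPlt (i : 'I_n0.+1) : (i < n0)%N -> DP X Q n0 eps i = dtilde X Q i.
  by rewrite /DP => ->.
have DPmax : DP X Q n0 eps ord_max = (dtilde X Q n0 + eps%:E)%E.
  by rewrite /DP ltnn.
have Jdt (i : nat) : (i < n0)%N -> joining_quotes X Q i (dtilde X Q i).
  move=> i_lt; have J0 : joining_quotes X Q i !=set0.
    by exists 0%E; split => //; exact: util0_ge0 hup.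
  by rewrite (dtilde_sup J0); exact: sup_joining_quotes.
have DP_adm : admissible X Q (DP X Q n0 eps).
  split => [i|i i_lt|].
  - have [i_lt|] := ltnP i n0; first by rewrite DPlt//; case: (Jdt i i_lt).
    by rewrite /DP ltnNge => ->.
  - by rewrite DPlt//; case: (Jdt i i_lt).
  - rewrite DPmax; apply: util_dtilde_gt => //.
    have [n n_le n_lim] := n_lower_attained hlow.
    apply: le_lt_trans (lim_util_lt0 hrisk l0 n_lim).
    by apply: util_pinfty_nincr => //; exact: ltW.
split => //; apply/eqP; rewrite eq_le; apply/andP; split.
  by apply: ereal_sup_ubound; exists (DP X Q n0 eps).
apply: ge_ereal_sup => _ [D [D0 Dlt _] <-].
apply: lee_wpmul2l; first by rewrite lee_fin ltW.
apply: lee_sum => i i_lt; apply: lee_wpmul2l.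
  have load_ge0 : 0 <= load Q by rewrite divr_ge0 ?ltW.
  by rewrite lee_fin divr_ge0 ?exprn_ge0// sumr_ge0// => k _; rewrite exprn_ge0.
by rewrite DPlt//; apply: gain_le_dtilde => //; exact: Dlt.
Qed.
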